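(* Let $n\ge 1$ be an integer and let $N=2^n+1$ or $N=2^n+3$. A set $A$ of integers of cardinality $n$ is sumset-distinct modulo $N$ if and only if there exist an integer $\lambda$ with $\gcd(\lambda,N)=1$ and signs $\sigma_0,\ldots,\sigma_{n-1}\in\{+1,-1\}$ such that $A=\{\sigma_0\lambda 2^0,\sigma_1\lambda 2^1,\ldots,\sigma_{n-1}\lambda 2^{n-1}\} \pmod N$, i.e. the elements of $A$ can be listed as $a_0,\ldots,a_{n-1}$ with $a_i\equiv \sigma_i\lambda 2^i \pmod N$ for all $0\le i\le n-1$.
   Context: A finite set of integers is called sumset-distinct modulo $N$ if all of its subsets (including the empty set, whose sum is $0$) have pairwise distinct sums modulo $N$. *)

(* Defs.v *)
From mathcomp Require Import all_boot all_order all_algebra.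
From mathcomp Require Import finmap.
Set Implicit Arguments.
Unset Strict Implicit.
Unset Printing Implicit Defensive.
Import GRing.Theory Num.Theory.
Local Open Scope ring_scope.

Definition sumset_distinct_mod (N : nat) (A : {fset int}) : Prop :=
  forall B C : {fset int}, (B `<=` A)%fset -> (C `<=` A)%fset ->
    (\sum_(x <- B) x = \sum_(x <- C) x %[mod N%:Z])%Z -> B = C.

(* Main.v *)
Require Import Defs.
From mathcomp Require Import all_boot all_order all_algebra.
From mathcomp Require Import finmap.
From mathcomp Require Import zify ring.
Set Implicit Arguments.
Unset Strict Implicit.
Unset Printing Implicit Defensive.
Import GRing.Theory Num.Theory.

(** Work in Z/N and let the subset sums of a family of n residues be distinct.
    Subtracting half of the total makes complementary subsets have opposite
    sums, so the centred sums are symmetric and miss 0; since they miss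
    N - 2^n residues, the missed ones (the holes) are 0 alone, or 0, d and -d.

    Fix a member a of the family.  The sums avoiding a, a set U, and its
    translate U + a split the complement of the holes.  Hence along a walk x,
    x + a, x + 2a, and so on, membership in U alternates as long as no hole is
    met.  As N is odd, a closed walk cannot avoid the holes, and this forces a
    to be a unit ([tiles_unit]).  With three holes, U is determined completely by
    the residue d / a = u or -u with 0 < u < N/2, and u must be odd
    ([tiles_profile]).  Measured in steps of 2a, the set U is a union of three blocks of lengths p,
    q, p with u = 2p + 1, and a single block when p = 0 or when there is one
    hole ([tiles_blocks]).

    If 6u < N for one member a, the middle block dominates.  The other members
    of the family, measured in steps of 2a, are then too short to wrap around
    N, and up to sign they become positive integers whose subset sums fill the
    three blocks ([lift_block_sums]).  With p > 0 this is impossible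
    ([no_three_blocks]); with p = 0 each of these integers tiles an interval of
    length 2^(n-1) together with its translate, so it is a power of two
    ([dvd_of_tiled_interval]), and the family consists of a and of the 2a * 2^k
    up to sign.

    It remains to find a with 6u < N when there are three holes.  If 6u > N for
    every member, then the explicit form of U shows that the subset with
    centred sum 4d and the subset with centred sum 5d contain the same members
    ([profile_4_5], [small_profile]), which is absurd.  This uses that d is a
    unit; otherwise the indicator function of the multiples of d, with values in
    the field with three elements, would be a non-constant function whose
    correlation with the subset sums is constant ([hole_step_unit]). *)

(** * Positive integers whose subset sums fill given blocks *)

(** The points below b lie in U, the next b points in its translate, and so on
    alternately.  The last b points of the interval must lie in the translate,
    so they form exactly one run. *)
Lemma dvd_of_tiled_interval (m b : nat) (U : pred nat) :
  0 < b -> b <= m ->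
  (forall x, (x < m) = U x (+) ((b <= x) && U (x - b))) ->
  (forall x, ~~ (U x && ((b <= x) && U (x - b)))) ->
  b %| m.
Proof.
move=> b0 bm HS Hn.
have flip x : x < m -> U x = ~~ odd (x %/ b).
  elim/ltn_ind: x => x IH xm; move: (HS x); rewrite xm.
  case: (leqP b x) => bx /=; last by rewrite addbF divn_small.
  rewrite (IH (x - b)); [|lia|lia].
  have -> : x %/ b = ((x - b) %/ b).+1 by rewrite -[in LHS](subnK bx) divnDr ?divnn ?b0 ?addn1.
  by rewrite /=; case: (U x); case: (odd _).
(* x + b is beyond the interval, so neither x nor x + b is in U. *)
have last x : m - b <= x -> x < m -> odd (x %/ b).
  move=> h1 h2; move: (HS (x + b)) (Hn (x + b)).
  rewrite leq_addl addnK /= ltnNge (_ : m <= x + b); last lia.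
  by rewrite (flip x) // /=; case: (U _); case: (odd _).
have h1 := last (m - b) (leqnn _) ltac:(lia).
have h2 := last m.-1 ltac:(lia) ltac:(lia).
have e1 := divn_eq (m - b) b; have r1 := ltn_pmod (m - b) b0.
have e2 := divn_eq m.-1 b; have r2 := ltn_pmod m.-1 b0.
move: h1 h2 e1 r1 e2 r2.
set Q := (m - b) %/ b; set Q' := m.-1 %/ b; set r := (m - b) %% b; set r' := _ %% b.
move=> h1 h2 e1 r1 e2 r2.
have QQ : Q = Q'.
  have : Q <= Q' by rewrite leq_div2r //; lia.
  have : Q' <= Q.+1.
    rewrite -ltnS -(ltn_pmul2r b0); nia.
  rewrite leq_eqVlt => /orP[/eqP e|]; last by lia.
  by move: h2; rewrite e /= h1.
have : m = Q.+2 * b - b by nia.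
by move=> ->; rewrite dvdn_sub // ?dvdn_mull.
Qed.

(** Shape of the set of centred sums avoiding a member a, measured in steps of
    2a: blocks of lengths p, q and p, separated by two gaps of length p + 1. *)
Definition blocks p q z :=
  [|| z < p, 2 * p + 1 <= z <= 2 * p + q |
      3 * p + 2 + q <= z <= 4 * p + 1 + q].

(** A summand of size at least p has size at least 2p + 1, since it must jump the
    first gap, while sums of smaller ones never leave the first block.  As the
    sums are distinct, an element of the middle block just after a filled run
    of length p must itself be a summand.  This produces the summands 2p + 1,
    3p + 1, 4p + 1 and 5p + 1, and the first and the last have the same sum as
    the two others. *)
Lemma no_three_blocks (I : finType) (b : I -> nat) p q :
  0 < p -> 4 * p + 2 <= q ->
  injective (fun K : {set I} => \sum_(j in K) b j) ->
  (forall K : {set I}, blocks p q (\sum_(j in K) b j)) ->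
  (forall z, blocks p q z -> exists K : {set I}, \sum_(j in K) b j = z) ->
  False.
Proof.
move=> p0 qp inj sub sur.
have bl j : blocks p q (b j) by move: (sub [set j]); rewrite big_set1.
have split (K : {set I}) j : j \in K -> \sum_(k in K) b k = b j + \sum_(k in K :\ j) b k.
  by move=> jK; rewrite (big_setD1 j).
have memle (K : {set I}) j : j \in K -> b j <= \sum_(k in K) b k.
  by move=> /split->; rewrite leq_addr.
have small (K : {set I}) : (forall j, j \in K -> b j < p) -> \sum_(j in K) b j < p.
  move: {2}#|K| (leqnn #|K|) => k; elim: k K => [|k IH] K.
    by rewrite leqn0 cards_eq0 => /eqP-> _; rewrite big_set0.
  have [->|[j jK]] := set_0Vmem K; first by rewrite big_set0.
  move=> Kk sm; have h : #|K :\ j| <= k by move: (cardsD1 j K); rewrite jK; lia.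
  have := IH _ h (fun i => fun iK => sm i (subsetP (subD1set _ _) i iK)).
  have := sm j jK; have := sub K; rewrite (split K j jK) /blocks; lia.
have large (K : {set I}) : p <= \sum_(j in K) b j -> exists2 j, j \in K & 2 * p + 1 <= b j.
  move=> h; case: (boolP [exists j in K, 2 * p + 1 <= b j]) => [/existsP[j /andP[]]|].
    by exists j.
  move=> /existsPn no; suff: \sum_(j in K) b j < p by lia.
  apply: small => j jK; have := no j; rewrite jK /=; have := bl j; rewrite /blocks; lia.
(* The summands j0 and j would differ by a sum of summands smaller than p, which
   gives two subsets with the same sum. *)
have uniq_block j0 j : p <= b j0 -> b j0 <= b j < b j0 + p -> j = j0.
  move=> h1 h2; have /sur[R eR] : blocks p q (b j - b j0) by rewrite /blocks; lia.
  have nR : j0 \notin R by apply/negP => /memle; lia.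
  have : [set j] = j0 |: R.
    by apply: inj; rewrite big_set1 big_setU1 //= eR; lia.
  by move=> /setP/(_ j0); rewrite !inE eqxx => /eqP.
have start : exists j, b j = 2 * p + 1.
  have /sur[K eK] : blocks p q (2 * p + 1) by rewrite /blocks; lia.
  have [|j jK jl] := large K; first by lia.
  by exists j; have := memle _ _ jK; lia.
have [j2 e2] := start.
(* Two distinct summands of size at least p add up to at least (2p + 1) + (3p + 1),
   so the sum x + p contains only one of them. *)
have next x j0 : 2 * p + 1 <= x -> b j0 = x -> x + p <= 5 * p + 1 -> exists j, b j = x + p.
  move=> xl e0 xs.
  have /sur[K eK] : blocks p q (x + p) by rewrite /blocks; lia.
  have [|j jK jl] := large K; first by lia.
  move: eK; rewrite (split K j jK); set r := \sum_(k in _) _ => er.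
  have [r0|r1] : r < p \/ 2 * p + 1 <= r by have := sub (K :\ j); rewrite -/r /blocks; lia.
    exists j; case: (ltnP 0 r) => r0'; last by lia.
    have : j = j0 by apply: uniq_block; lia.
    by move=> ej; move: er; rewrite ej e0; lia.
  have [|j' j'K j'l] := large (K :\ j); first by rewrite -/r; lia.
  have := memle _ _ j'K; rewrite -/r => j'r.
  have ej' : j' = j2 by apply: uniq_block; lia.
  have ej : j = j2 by apply: uniq_block; lia.
  by move: j'K; rewrite ej' ej !inE eqxx.
have [j3 e3] := next (2 * p + 1) j2 (leqnn _) e2 ltac:(lia).
have [j4 e4] := next (2 * p + 1 + p) j3 ltac:(lia) e3 ltac:(lia).
have [j5 e5] := next (2 * p + 1 + p + p) j4 ltac:(lia) e4 ltac:(lia).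
have neq i j : b i < b j -> i \notin [set j] by rewrite inE; case: eqP => // ->; lia.
have : [set j2; j5] = [set j3; j4].
  apply: inj; rewrite /= big_setU1 ?neq ?big_setU1 ?neq ?big_set1 /=; lia.
move=> /setP/(_ j2); rewrite !inE eqxx /= => /esym/orP[]/eqP e; move: e2; rewrite e; lia.
Qed.

(** * Small residues modulo N *)

Lemma Zp_natr_eq N x y : 1 < N -> (x%:R == y%:R :> 'Z_N)%R = (x == y %[mod N]).
Proof. by move=> N1; rewrite -val_eqE /= !val_Zp_nat. Qed.

Lemma Zp_natr_inj N x y : 1 < N -> x < N -> y < N ->
  (x%:R = y%:R :> 'Z_N)%R -> x = y.
Proof. by move=> N1 xN yN /eqP; rewrite Zp_natr_eq // !modn_small // => /eqP. Qed.

Lemma Zp_natr_val N (x : 'Z_N) : 1 < N -> exists2 z, z < N & x = (z%:R)%R.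
Proof.
move=> N1; exists (val x); last by rewrite natr_Zp.
by rewrite -[X in _ < X](Zp_cast N1) ltn_ord.
Qed.

Lemma Zp_natr_char N : 1 < N -> (N%:R = 0 :> 'Z_N)%R.
Proof. by move=> N1; apply/eqP; rewrite -[0%R]/(0%:R)%R Zp_natr_eq // modnn mod0n. Qed.

Lemma Zp_natr_eq_cases N x y : 1 < N -> x < N -> y < 2 * N ->
  (x%:R = y%:R :> 'Z_N)%R -> y = x \/ y = x + N.
Proof.
move=> N1 xN yN; case: (ltnP y N) => h; first by left; apply/esym/(@Zp_natr_inj N).
move=> e; right; suff: x = y - N by lia.
apply: (@Zp_natr_inj N) => //; first lia.
by rewrite e natrB // Zp_natr_char // subr0.
Qed.

(** Least absolute residues. *)
Lemma Zp_signed_rep N (x : 'Z_N) : 1 < N -> odd N ->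
  exists2 b, 2 * b < N & x = (b%:R)%R \/ x = (- b%:R)%R.
Proof.
move=> N1 oN; have [z zN ->] := Zp_natr_val x N1.
case: (ltnP (2 * z) N) => h; first by exists z; [|left].
exists (N - z); first lia.
by right; rewrite natrB ?(ltnW zN) // Zp_natr_char // sub0r opprK.
Qed.

(** Changing the signs of some members of a family translates its subset sums:
    only the subset giving each sum changes. *)
Lemma sum_sign_flip (R : zmodType) (I : finType) (f g : I -> R) (P K : {set I}) :
  (forall j, f j = if j \in P then - g j else g j)%R ->
  (\sum_(j in [set j | (j \in K) (+) (j \in P)]) f j =
    \sum_(j in P) f j + \sum_(j in K) g j)%R.
Proof.
move=> fg; rewrite [LHS]big_mkcond [X in (X + _)%R]big_mkcond [X in (_ + X)%R]big_mkcond.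
rewrite -big_split; apply: eq_bigr => j _; rewrite inE fg.
by case: (j \in K); case: (j \in P); rewrite /= ?addr0 ?add0r ?addNr.
Qed.

(** Adding or removing the member j moves each point of the blocks to another one.
    If the step were at least q, then points of the middle block would move into
    one of the two outer blocks, of length p; this fails for one of three points
    of the middle block spaced by p. *)
Lemma signed_step_bound N (I : finType) (be : I -> 'Z_N) (x1 : 'Z_N) p q :
  1 < N -> odd N -> 4 * p + 2 * q + 1 <= N -> 2 * p + 1 <= q ->
  injective (fun K : {set I} => x1 + \sum_(j in K) be j)%R ->
  (forall z, z < N ->
    blocks p q z <-> exists K : {set I}, (x1 + \sum_(j in K) be j = z%:R)%R) ->
  forall j, exists2 b, 0 < b < q & be j = (b%:R)%R \/ be j = (- b%:R)%R.
Proof.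
move=> N1 oN Npq qp inj img j.
have [b bN bE] := Zp_signed_rep (be j) N1 oN.
have b0 : 0 < b.
  rewrite lt0n; apply/eqP => b0; have be0 : be j = 0%R by case: bE => ->; rewrite b0 ?oppr0.
  have /setP/(_ j) : [set j] = set0 by apply: inj; rewrite /= big_set1 big_set0 be0.
  by rewrite !inE eqxx.
exists b => //; rewrite b0 ltnNge; apply/negP => qb.
have partner z : blocks p q z -> exists2 z', blocks p q z' &
    [\/ z + b = z', z + b = z' + N, z' + b = z | z' + b = z + N].
  move=> bz; have zN : z < N by move: bz; rewrite /blocks; lia.
  have [K eK] := (img z zN).1 bz.
  have [K' eK'] : exists K' : {set I}, (x1 + \sum_(j in K') be j = z%:R + be j \/
      x1 + \sum_(j in K') be j = z%:R - be j)%R.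
    case: (boolP (j \in K)) => jK.
      by exists (K :\ j); right; rewrite -eK (big_setD1 j jK) /= addrA addrAC addrK.
    by exists (j |: K); left; rewrite -eK big_setU1 //= addrCA addrC.
  have [z' z'N ez'] := Zp_natr_val (x1 + \sum_(j in K') be j)%R N1.
  exists z'; first by apply/(img z' z'N); exists K'.
  have {eK'}[e|e] : (z'%:R = (z + b)%:R :> 'Z_N)%R \/ (z%:R = (z' + b)%:R :> 'Z_N)%R.
    rewrite !natrD -ez'.
    case: eK' => ->; case: bE => ->; [left|right|right|left]; ring.
  - have [//||->|->] := Zp_natr_eq_cases N1 _ _ e; first lia.
      by constructor 1.
    by constructor 2.
  - have [//||->|->] := Zp_natr_eq_cases N1 _ _ e; first lia.
      by constructor 3.
    by constructor 4.
have [|z1 h1 e1] := partner (2 * p + 1); first by rewrite /blocks; lia.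
have [|z2 h2 e2] := partner (3 * p + 1); first by rewrite /blocks; lia.
have [|z3 h3 e3] := partner (4 * p + 1); first by rewrite /blocks; lia.
move: h1 h2 h3; rewrite /blocks; case: e1 => e1; case: e2 => e2; case: e3 => e3; lia.
Qed.

(** * Lifting subset sums from Z/N to the integers *)

(** The blocks span 4p + q + 2 residues and a step is shorter than q, so adding a
    member to a subset never wraps around N.  Congruences between points of the
    blocks are therefore equalities of integers. *)
Lemma lift_block_sums N (I : finType) (b : I -> nat) (x1 : 'Z_N) p q :
  1 < N -> 4 * p + 2 * q + 1 <= N -> (forall j, b j < q) -> 0 < q ->
  (forall z, z < N ->
    blocks p q z <->
    exists K : {set I}, (x1 + (\sum_(j in K) b j)%N%:R = z%:R)%R) ->
  exists z0,
    (forall K : {set I}, blocks p q (z0 + \sum_(j in K) b j)) /\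
    (forall z, blocks p q z -> exists K : {set I}, z0 + \sum_(j in K) b j = z).
Proof.
move=> N1 Npq bq pq img.
have [z0 z0N x1E] := Zp_natr_val x1 N1; exists z0.
have bN z : blocks p q z -> z < N by rewrite /blocks; lia.
have sub (K : {set I}) : blocks p q (z0 + \sum_(j in K) b j).
  move: {2}#|K| (leqnn #|K|) => k; elim: k K => [|k IH] K.
    rewrite leqn0 cards_eq0 => /eqP->; rewrite big_set0 addn0.
    by apply/(img _ z0N); exists set0; rewrite big_set0 addr0.
  have [->|[j jK]] := set_0Vmem K.
    move=> _; have := IH set0; rewrite cards0; exact.
  move=> Kk; have h : #|K :\ j| <= k by move: (cardsD1 j K); rewrite jK; lia.
  have {IH} := IH _ h; rewrite (big_setD1 j jK) /=; set s := \sum_(i in K :\ j) _ => bs.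
  have [z zN ez] := Zp_natr_val (x1 + (\sum_(j in K) b j)%N%:R)%R N1.
  have bz : blocks p q z by apply/(img _ zN); exists K.
  move: ez; rewrite (big_setD1 j jK) /= -/s x1E -natrD => /esym ez.
  have bj := bq j; have [|->//|e] := Zp_natr_eq_cases N1 zN _ ez.
    by move: bs; rewrite /blocks; lia.
  by move: bs bz; rewrite /blocks; lia.
split=> // z bz; have [K eK] := (img _ (bN _ bz)).1 bz.
exists K; apply: (Zp_natr_inj N1) (bN _ (sub K)) (bN _ bz) _.
by rewrite natrD -x1E.
Qed.

(** After making all members positive, their subset sums fill the translated
    blocks in the integers.  The three-block case is contradictory, and in an
    interval of length 2^m each member divides 2^m. *)
Lemma blocks_subset_sums N (I : finType) (be : I -> 'Z_N) (x1 : 'Z_N) p q :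
  1 < N -> odd N -> 4 * p + 2 * q + 1 <= N ->
  p = 0 /\ q = 2 ^ #|I| \/ 0 < p /\ 4 * p + 2 <= q ->
  injective (fun K : {set I} => x1 + \sum_(j in K) be j)%R ->
  (forall z, z < N ->
    blocks p q z <-> exists K : {set I}, (x1 + \sum_(j in K) be j = z%:R)%R) ->
  exists2 e : I -> nat, injective e &
    forall j, e j < #|I| /\ (be j = (2 ^ e j)%:R \/ be j = - (2 ^ e j)%:R)%R.
Proof.
move=> N1 oN Npq pq inj img.
have q0 : 2 * p + 1 <= q by have := expn_gt0 2 #|I|; lia.
have /fin_all_exists[b bP] : forall j, exists b : nat,
    0 < b < q /\ (be j = b%:R \/ be j = (- b%:R))%R.
  move=> j; by have [b] := signed_step_bound N1 oN Npq q0 inj img j; exists b.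
(* Members that are the opposite of b j. *)
pose P := [set j | be j != (b j)%:R%R].
have beE j : (be j = if j \in P then - (b j)%:R else (b j)%:R)%R.
  by rewrite inE; case: eqP => //= ne; case: (bP j) => _ [].
pose flip (K : {set I}) := [set j | (j \in K) (+) (j \in P)].
have flipK : involutive flip by move=> K; apply/setP=> j; rewrite !inE -addbA addbb addbF.
pose x2 : 'Z_N := (x1 + \sum_(j in P) be j)%R.
have flipE (K : {set I}) : (x2 + (\sum_(j in K) b j)%N%:R = x1 + \sum_(j in flip K) be j)%R.
  by rewrite (sum_sign_flip _ beE) natr_sum addrA.
have binj : injective (fun K : {set I} => \sum_(j in K) b j).
  move=> K K' /= e; apply: (inv_inj flipK); apply: inj => /=.
  by rewrite -!flipE e.
have [//|//||||z0 [sub sur]] := @lift_block_sums N I b x2 p q.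
- by move=> j; case: (bP j) => /andP[].
- by lia.
- move=> z zN; rewrite img //; split=> -[K eK].
    by exists (flip K); rewrite flipE flipK.
  by exists (flip K); rewrite -flipE.
have b0 := sub set0; rewrite big_set0 addn0 in b0.
case: pq => [[p0 qE]|[p0 qp]]; last first.
  (* 0 lies in the first block, so the least subset sum is at the origin. *)
  have z00 : z0 = 0 by have [] := sur 0; [rewrite /blocks; lia | move=> K; lia].
  rewrite z00 in sub sur.
  by have := no_three_blocks p0 qp binj sub sur.
(* With p = 0 the middle block starts at 1. *)
have z01 : z0 = 1.
  have [|K] := sur 1; first by rewrite /blocks; lia.
  by move: b0; rewrite /blocks; lia.
have {}sub (K : {set I}) : \sum_(j in K) b j < q by move: (sub K); rewrite /blocks; lia.
have {}sur z : z < q -> exists K : {set I}, \sum_(j in K) b j = z.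
  move=> zq; have [|K eK] := sur z.+1; first by rewrite /blocks; lia.
  by exists K; lia.
have /fin_all_exists[e eP] : forall j, exists e, e < #|I| /\ b j = 2 ^ e.
  move=> j.
  pose U x := [exists K : {set I}, (j \notin K) && (\sum_(i in K) b i == x)].
  have [/andP[bj0 bjq] _] := bP j.
  have Ucore (K : {set I}) : U (\sum_(i in K) b i) = (j \notin K).
    apply/existsP/idP => [[K' /andP[jK' /eqP/binj <-]] //|jK].
    by exists K; rewrite jK eqxx.
  have shift x : (b j <= x) && U (x - b j) ->
      exists2 K : {set I}, j \notin K & x = \sum_(i in j |: K) b i.
    move=> /andP[bx /existsP[K /andP[jK /eqP eK]]]; exists K => //.
    by rewrite big_setU1 //= eK subnKC.
  have dv : b j %| q.
    apply: (@dvd_of_tiled_interval q (b j) U) => //; first exact: ltnW.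
    - move=> x; case: (ltnP x q) => xq.
        have [K eK] := sur x xq; rewrite -eK Ucore.
        case: (boolP (j \in K)) => jK /=.
          by rewrite (big_setD1 j jK) /= leq_addr addKn Ucore !inE eqxx.
        by apply/esym/negP => /shift [K' jK' /binj eKK']; rewrite eKK' setU11 in jK.
      case: (U x) (fun h : U x = true => existsP h) => [/(_ isT)[K /andP[_ /eqP eK]]|_ /=].
        by have := sub K; lia.
      by apply/esym/negP => /shift [K' _ eK]; have := sub (j |: K'); lia.
    - move=> x; apply/negP => /andP[/existsP[K /andP[jK /eqP eK]] /shift [K' _ e]].
      by move: jK; rewrite (binj K (j |: K')) ?setU11 //= eK e.
  have /(dvdn_pfactor _ _ (isT : prime 2))[k kI bk] : b j %| 2 ^ #|I| by rewrite -qE.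
  exists k; split=> //; rewrite ltn_neqAle kI andbT; apply: contraTneq bjq => ek.
  by rewrite bk ek qE ltnn.
exists e; last by move=> j; case: (eP j) => ? <-; split=> //; case: (bP j).
move=> i j eij; apply/set1P.
suff -> : [set j] = [set i] by rewrite inE.
by apply: binj; rewrite !big_set1 (eP i).2 (eP j).2 eij.
Qed.

(** * Stepping through a tiled set modulo N *)

(** The case of a single hole is d = 0. *)
Definition hole N (d x : 'Z_N) := ((x == 0) || (x == d) || (x == - d))%R.

(** The complement of the holes is the disjoint union of U and U + a.  The pointwise
    exclusive-or form is what an induction along steps of a uses. *)
Definition tiles N (d a : 'Z_N) (U : pred 'Z_N) :=
  forall x, ~~ hole d x = U x (+) U (x - a)%R /\ ~~ (U x && U (x - a)%R).

Section Tiling.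
Variables (N : nat) (N1 : 1 < N) (oN : odd N).
Variables (d a : 'Z_N) (U : pred 'Z_N) (tU : tiles d a U).
Local Open Scope ring_scope.

Lemma unit2 : (2%:R : 'Z_N) \is a GRing.unit.
Proof. by rewrite unitZpE // coprimen2. Qed.

Lemma tiles_holeF x : hole d x -> U x = false /\ U (x - a) = false.
Proof. by have [] := tU x; move=> + + hx; rewrite hx /=; case: (U x); case: (U _). Qed.

Lemma tiles_step x : ~~ hole d (x + a) -> U (x + a) = ~~ U x.
Proof.
by have [+ _] := tU (x + a); rewrite addrK => + hx; rewrite hx; case: (U x); case: (U _).
Qed.

Lemma tiles_alternate x0 l :
  (forall k, (k < l)%N -> ~~ hole d (x0 + k.+1%:R * a)) ->
  forall k, (k <= l)%N -> U (x0 + k%:R * a) = odd k (+) U x0.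
Proof.
move=> nh; elim=> [|k IH] kl; first by rewrite mul0r addr0.
have e : x0 + k.+1%:R * a = x0 + k%:R * a + a by rewrite -addn1 natrD; ring.
by rewrite e tiles_step -?e ?nh // IH ?(ltnW kl) //= addNb.
Qed.

(** Otherwise membership in U would alternate along a closed walk of odd length N. *)
Lemma tiles_hits_hole x : exists k, hole d (x + k%:R * a).
Proof.
case: (boolP [exists k : 'I_N, hole d (x + k.+1%:R * a)]) => [/existsP[k hk]|/existsPn nh].
  by exists k.+1.
have := @tiles_alternate x N (fun k kN => nh (Ordinal kN)) N (leqnn N).
by rewrite Zp_natr_char // mul0r addr0 oN /=; case: (U x).
Qed.

(** Every coset of the subgroup generated by a contains a hole.  The coset of 2d
    then puts 2d, d or 3d into the subgroup, hence d as 2 and 3 are units; so all holes lie in the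
    subgroup, and so does 1. *)
Lemma tiles_unit : d = 0 \/ (3%:R : 'Z_N) \is a GRing.unit -> a \is a GRing.unit.
Proof.
move=> d3.
have [c dE] : exists c, d = c * a.
  case: d3 => [->|u3]; first by exists 0; rewrite mul0r.
  have [k] := tiles_hits_hole (2%:R * d); rewrite /hole -orbA => /or3P[]/eqP h.
  - exists (- (2%:R^-1 * k%:R)); rewrite -[LHS](mulKr unit2).
    have -> : 2%:R * d = - (k%:R * a) by apply/eqP; rewrite -addr_eq0 h.
    ring.
  - exists (- k%:R); apply/eqP; rewrite mulNr -addr_eq0.
    have -> : d + k%:R * a = 2%:R * d + k%:R * a - d by ring.
    by rewrite h subrr.
  - exists (- (3%:R^-1 * k%:R)); rewrite -[LHS](mulKr u3).
    have -> : 3%:R * d = - (k%:R * a).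
      apply/eqP; rewrite -addr_eq0.
      have -> : 3%:R * d + k%:R * a = 2%:R * d + k%:R * a + d by ring.
      by rewrite h addNr.
    ring.
have [k] := tiles_hits_hole 1; rewrite /hole -orbA => hk.
have [v va] : exists v, v * a = 1.
  case/or3P: hk => /eqP h.
  - exists (- k%:R); rewrite mulNr; apply/esym/eqP; rewrite -addr_eq0; exact/eqP.
  - exists (c - k%:R); rewrite mulrBl -dE -h; ring.
  - exists (- c - k%:R); rewrite mulrBl mulNr -dE -h; ring.
by apply/unitrP; exists v; rewrite va mulrC va.
Qed.

Lemma tiles_multiples_alternate y0 l : U (a * y0%:R) = false ->
  (forall y, (y0 < y < y0 + l)%N -> ~~ hole d (a * y%:R)) ->
  forall y, (y0 <= y < y0 + l)%N -> U (a * y%:R) = odd (y - y0).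
Proof.
move=> U0 nh y yl.
have e k : a * y0%:R + k%:R * a = a * (y0 + k)%:R by rewrite natrD; ring.
have := @tiles_alternate (a * y0%:R) l.-1 _ (y - y0)%N; rewrite e U0 addbF subnKC; last lia.
by apply=> [k kl|]; [rewrite e; apply: nh|]; lia.
Qed.

Lemma tiles_profile0 y : d = 0 -> a \is a GRing.unit -> (y < N)%N -> U (a * y%:R) = odd y.
Proof.
move=> d0 ua yN; rewrite -[in RHS](subn0 y); apply: (@tiles_multiples_alternate 0 N) => //.
  by rewrite mulr0; apply: (tiles_holeF _).1; rewrite /hole eqxx.
move=> z zN; rewrite /hole d0 oppr0 !orbb -(mulr0 a) (inj_eq (mulrI ua)).
rewrite -[0]/(0%:R) Zp_natr_eq // !modn_small; lia.
Qed.

(** In steps of a, the holes are at 0, u and N - u, and membership in U restarts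
    with a non-member at each of them.  The position before a hole is a
    non-member as well, which makes the arc from 0 to u of odd length u. *)
Lemma tiles_profile : d != 0 -> a \is a GRing.unit ->
  exists u, [/\ (2 * u < N)%N, odd u, d = a * u%:R \/ d = - (a * u%:R) &
    forall y, (y < N)%N -> U (a * y%:R) = odd y (+) (u <= y < N - u)%N].
Proof.
move=> d0 ua.
have [u uN uE] := Zp_signed_rep (a^-1 * d) N1 oN.
have {}uE : d = a * u%:R \/ d = - (a * u%:R).
  by rewrite -[d](mulVKr ua); case: uE => ->; [left|right]; rewrite ?mulrN.
have u0 : (0 < u)%N.
  by rewrite lt0n; apply: contraNneq d0 => u0; case: uE => ->; rewrite u0 mulr0 ?oppr0.
have holeE y : (y < N)%N -> hole d (a * y%:R) = [|| y == 0%N, y == u | y == (N - u)%N].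
  move=> yN; have -> : hole d (a * y%:R) =
      [|| a * y%:R == a * 0%:R, a * y%:R == a * u%:R | a * y%:R == a * (N - u)%:R].
    rewrite /hole mulr0 natrB; last lia.
    rewrite Zp_natr_char // sub0r mulrN -orbA.
    by case: uE => ->; rewrite ?opprK //; congr (_ || _); rewrite orbC.
  by rewrite !(inj_eq (mulrI ua)) !Zp_natr_eq // !modn_small; lia.
have holeU y : (y < N)%N -> hole d (a * y%:R) -> U (a * y%:R) = false.
  by move=> _ /tiles_holeF[].
have h1 y : (y < u)%N -> U (a * y%:R) = odd y.
  move=> yu; rewrite -[in RHS](subn0 y); apply: (@tiles_multiples_alternate 0 u) => //.
    by apply: holeU; [|rewrite holeE]; lia.
  by move=> z zu; rewrite holeE; lia.
have ou : odd u.
  have [_] : U (a * u%:R) = false /\ U (a * u%:R - a) = false.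
    by apply: tiles_holeF; rewrite holeE ?eqxx ?orbT //; lia.
  have -> : a * u%:R - a = a * (u.-1)%:R by rewrite -[in LHS](prednK u0) -addn1 natrD; ring.
  by rewrite h1; [rewrite -[in odd u](prednK u0) /= => -> | lia].
have h2 y : (u <= y < N - u)%N -> U (a * y%:R) = odd (y - u).
  move=> yu; apply: (@tiles_multiples_alternate u (N - 2 * u)) => //; last lia.
    by apply: holeU; [|rewrite holeE]; lia.
  by move=> z zu; rewrite holeE; lia.
have h3 y : (N - u <= y < N)%N -> U (a * y%:R) = odd (y - (N - u)).
  move=> yu; apply: (@tiles_multiples_alternate (N - u) u) => //; last lia.
    by apply: holeU; [|rewrite holeE]; lia.
  by move=> z zu; rewrite holeE; lia.
exists u; split=> // y yN.
case: (ltnP y u) => yu /=; first by rewrite h1 // addbF.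
case: (ltnP y (N - u)) => yu' /=; first by rewrite h2; lia.
by rewrite h3; lia.
Qed.

End Tiling.

(** * Centred subset sums and the residues they miss *)

(** Position z in steps of 2a, counted from -2pa, is position 2(z - p) in steps of
    a; the three arcs between the holes then become the three blocks. *)
Lemma tiles_blocks N (a : 'Z_N) (U : pred 'Z_N) p q :
  1 < N -> N = 4 * p + 2 * q + 3 ->
  (forall y, y < N -> U (a * y%:R)%R = odd y (+) (2 * p + 1 <= y < N - (2 * p + 1))) ->
  forall z, z < N -> U (- (a * (2 * p)%:R) + (2%:R * a) * z%:R)%R = blocks p q z.
Proof.
move=> N1 NE prof z zN.
pose y := if z < p then N + 2 * z - 2 * p
          else if 2 * z - 2 * p < N then 2 * z - 2 * p else 2 * z - 2 * p - N.
have -> : (- (a * (2 * p)%:R) + 2%:R * a * z%:R = a * y%:R)%R.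
  have -> : (- (a * (2 * p)%:R) + 2%:R * a * z%:R = a * ((2 * z)%:R - (2 * p)%:R))%R.
    by rewrite !natrM; ring.
  congr (_ * _)%R; rewrite /y; case: ifP => h1; last case: ifP => h2.
  - by rewrite natrB ?natrD ?Zp_natr_char ?add0r //; lia.
  - by rewrite natrB //; lia.
  - by rewrite natrB ?natrB ?Zp_natr_char ?subr0 //; lia.
rewrite prof /blocks /y; last by case: ifP => h1; last case: ifP => h2; lia.
by case: ifP => h1; last case: ifP => h2; lia.
Qed.

Section SubsetSums.
Variables (N n : nat) (N1 : 1 < N) (oN : odd N).
Variables (alpha : 'I_n -> 'Z_N) (m : 'Z_N).
Local Open Scope ring_scope.

Definition csum (K : {set 'I_n}) : 'Z_N := \sum_(j in K) alpha j - m.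

Definition csum_avoiding (i : 'I_n) : pred 'Z_N :=
  fun x => [exists K : {set 'I_n}, (i \notin K) && (csum K == x)].

Hypothesis inj : injective csum.

Lemma csum_setU1 i (K : {set 'I_n}) : i \notin K -> csum (i |: K) = csum K + alpha i.
Proof. by move=> iK; rewrite /csum big_setU1 //= -addrA addrC. Qed.

Lemma csum_avoiding_csum i K : csum_avoiding i (csum K) = (i \notin K).
Proof.
apply/existsP/idP => [[K' /andP[iK' /eqP/inj <-]] //|iK].
by exists K; rewrite iK eqxx.
Qed.

Lemma csum_avoiding_tiles d i :
  (forall x, ~~ hole d x = [exists K, csum K == x]) -> tiles d (alpha i) (csum_avoiding i).
Proof.
move=> hd x.
have shift : csum_avoiding i (x - alpha i) ->
    exists2 K : {set 'I_n}, i \in K & csum K = x.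
  move=> /existsP[K /andP[iK /eqP eK]]; exists (i |: K); first exact: setU11.
  by rewrite csum_setU1 // eK subrK.
split; last first.
  apply/negP => /andP[h /shift[K iK eK]].
  by rewrite -eK csum_avoiding_csum iK in h.
rewrite hd; apply/existsP/idP => [[K /eqP<-]|].
  rewrite csum_avoiding_csum; case: (boolP (i \in K)) => iK /=.
    have -> : csum K - alpha i = csum (K :\ i).
      by rewrite -[in LHS](setD1K iK) csum_setU1 ?addrK // !inE eqxx.
    by rewrite csum_avoiding_csum !inE eqxx.
  apply/negP => /existsP[K' /andP[iK' /eqP eK']].
  have eK2 : i |: K' = K by apply: inj; rewrite csum_setU1 // eK' subrK.
  by move: iK; rewrite -eK2 setU11.
case: (boolP (csum_avoiding i x)) => [/existsP[K /andP[_ eK]] _|_ /= /shift[K _ <-]].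
  by exists K.
by exists K.
Qed.

End SubsetSums.

(** Halving the total is possible as N is odd.  The residue 0 is missed because a
    subset with centred sum 0 would have the same sum as its complement; the set
    of missed residues is symmetric and has N - 2^n elements. *)
Lemma csum_holes N n (alpha : 'I_n -> 'Z_N) : 0 < n ->
  N = 2 ^ n + 1 \/ N = 2 ^ n + 3 ->
  injective (fun K : {set 'I_n} => \sum_(j in K) alpha j)%R ->
  exists m d, [/\ injective (csum alpha m),
    forall K, (csum alpha m (~: K) = - csum alpha m K)%R,
    (forall x, ~~ hole d x = [exists K, csum alpha m K == x]) &
    N = 2 ^ n + 1 /\ d = 0%R \/ N = 2 ^ n + 3 /\ d != 0%R].
Proof.
move=> n0 NE inj.
have e2 : 2 ^ n = 2 * 2 ^ n.-1 by rewrite -expnS prednK.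
have e20 := expn_gt0 2 n.-1.
have N1 : 1 < N by lia.
have oN : odd N by lia.
have u2 := unit2 N1 oN.
pose m : 'Z_N := ((\sum_j alpha j) / 2%:R)%R.
have m2 : (m + m = \sum_j alpha j)%R by rewrite -mulr2n -mulr_natr divrK.
have finj : injective (csum alpha m) by move=> K K' /addIr/inj.
have compl K : (csum alpha m (~: K) = - csum alpha m K)%R.
  apply/eqP; rewrite -addr_eq0 /csum addrACA -opprD m2 subr_eq0 eq_sym.
  rewrite (bigID [in K]) /= addrC; apply/eqP; congr (_ + _)%R.
  by apply: eq_bigl => j; rewrite inE.
pose im := [set csum alpha m K | K in [set: {set 'I_n}]].
have cim : #|im| = 2 ^ n.
  by rewrite card_imset // -powersetT card_powerset cardsT card_ord.
have imE x : (x \in im) = [exists K, csum alpha m K == x].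
  by apply/imsetP/existsP => -[K]; [move=> _ ->; exists K | move=> /eqP<-; exists K].
have cC : #|~: im| = N - 2 ^ n by rewrite cardsCs setCK cim card_ord Zp_cast.
have eq_opp (x : 'Z_N) : x = (- x)%R -> x = 0%R.
  move=> /eqP; rewrite -addr_eq0 -mulr2n -mulr_natl => /eqP h.
  by rewrite -[x](mulKr u2) h mulr0.
have C0 : 0%R \in ~: im.
  rewrite inE imE; apply/existsP => -[K /eqP K0].
  have /setP/(_ (Ordinal n0)) : K = ~: K by apply: finj; rewrite compl K0 oppr0.
  by rewrite inE; case: (_ \in K).
have CN x : x \in ~: im -> (- x)%R \in ~: im.
  rewrite !inE; apply: contra; rewrite !imE => /existsP[K /eqP eK].
  by apply/existsP; exists (~: K); rewrite compl eK opprK.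
suff [d dE dN] : exists2 d, ~: im = [set x | hole d x] &
    N = 2 ^ n + 1 /\ d = 0%R \/ N = 2 ^ n + 3 /\ d != 0%R.
  exists m, d; split=> // x; rewrite -imE -[im]setCK dE !inE.
  by [].
case: NE => NE.
  exists 0%R; last by left.
  apply/esym/eqP; rewrite eqEcard; apply/andP; split.
    by apply/subsetP => x; rewrite inE /hole oppr0 !orbb => /eqP->.
  by rewrite cC (cardD1 0%R) inE /hole eqxx NE addKn.
have /set0Pn[d] : ~: im :\ 0%R != set0.
  rewrite -card_gt0; have := cardsD1 0%R (~: im); rewrite C0 cC.
  by set c := (X in _ = _ + X) => e; change (0 < c); lia.
case/setD1P => d0 dC.
exists d; last by right.
apply/esym/eqP; rewrite eqEcard; apply/andP; split.
  by apply/subsetP => x; rewrite inE /hole -orbA => /or3P[]/eqP-> //; apply: CN.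
have -> : [set x | hole d x] = [set 0; d; - d]%R by apply/setP=> x; rewrite !inE.
rewrite -setUA cardsU1 cards2 !inE cC.
have -> : d != (- d)%R by apply: contraNneq d0 => /eq_opp->.
rewrite !(eq_sym 0%R) oppr_eq0 (negbTE d0); lia.
Qed.

(** * The spacing of the holes is a unit *)

Lemma sum_subsets_setD1 (V : nmodType) (I : finType) (F : {set I} -> V) (X : {set I}) j :
  j \in X ->
  (\sum_(K : {set I} | K \subset X) F K = \sum_(K : {set I} | K \subset X :\ j) (F K + F (j |: K)))%R.
Proof.
move=> jX; rewrite (bigID (fun K : {set I} => j \in K)) /= addrC big_split /=; congr (_ + _)%R.
  by apply: eq_bigl => K; rewrite subsetD1.
rewrite (reindex_onto (fun K => j |: K) (fun K => K :\ j)) /=; last first.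
  by move=> K /andP[_ jK]; rewrite setD1K.
apply: eq_bigl => K; rewrite setU11 andbT subUset sub1set jX /= subsetD1.
case: (boolP (j \in K)) => jK; last by rewrite setU1K // eqxx.
rewrite !andbF; apply/negbTE; rewrite negb_and; apply/orP; right; apply/eqP => e.
by move: jK; rewrite -e !inE eqxx.
Qed.

(** The profile of X sums h (x - s) over the subset sums s of X.  If it is constant,
    the profile g of X without an index j is such that
    g x + g (x - a_j) is constant, so it has period 2 a_j, a unit, and is
    constant too; for the empty set the profile is h itself. *)
Lemma subset_sum_profile_const N (V : zmodType) (I : finType) (al : I -> 'Z_N) (h : 'Z_N -> V) :
  1 < N -> odd N -> (forall j, al j \is a GRing.unit)%R ->
  forall X : {set I},
  (forall x, \sum_(K : {set I} | K \subset X) h (x - \sum_(j in K) al j) =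
             \sum_(K : {set I} | K \subset X) h (- \sum_(j in K) al j))%R ->
  (forall x, h x = h 0)%R.
Proof.
move=> N1 oN ual X; move: {2}#|X| (leqnn #|X|) => k; elim: k X => [|k IH] X.
  rewrite leqn0 cards_eq0 => /eqP-> + x.
  have sub0 (K : {set I}) : (K \subset set0) = (K == set0) by rewrite subset0.
  move=> /(_ x); rewrite !(eq_bigl _ _ sub0) !big_pred1_eq big_set0.
  by rewrite oppr0 addr0.
have [->|[j jX]] := set_0Vmem X; first by move=> _; apply: IH; rewrite cards0.
move=> Xk; have hk : #|X :\ j| <= k by move: (cardsD1 j X); rewrite jX; lia.
pose g x := (\sum_(K : {set I} | K \subset X :\ j) h (x - \sum_(i in K) al i))%R.
have gX x : (\sum_(K : {set I} | K \subset X) h (x - \sum_(i in K) al i) = g x + g (x - al j))%R.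
  rewrite (sum_subsets_setD1 _ jX) big_split /=; congr (_ + _)%R.
  apply: eq_bigr => K; rewrite subsetD1 => /andP[_ jK].
  by rewrite big_setU1 //= opprD addrA.
move=> c0; have {}c0 x y : (g x + g (x - al j) = g y + g (y - al j))%R.
  have := c0 x; rewrite gX => ->; have := c0 y; rewrite gX => ->; exact: erefl.
have g2 x : (g x = g (x + 2%:R * al j))%R.
  have := c0 (x + al j)%R (x + 2%:R * al j)%R.
  rewrite addrK (_ : x + 2%:R * al j - al j = x + al j)%R; last by ring.
  by rewrite addrC => /addIr.
have gk t x : (g x = g (x + t%:R * (2%:R * al j)))%R.
  elim: t => [|t ->]; first by rewrite mul0r addr0.
  by rewrite g2 -[t.+1]addn1 natrD; congr g; ring.
apply: (IH _ hk) => x; rewrite -/(g x).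
have -> : (\sum_(K : {set I} | K \subset X :\ j) h (- \sum_(i in K) al i) = g 0)%R.
  by apply: eq_bigr => K _; rewrite sub0r.
have u2 : (2%:R * al j \is a GRing.unit)%R by rewrite unitrMl // unit2.
have [t _ tE] := Zp_natr_val (x / (2%:R * al j))%R N1.
by rewrite [in RHS](gk t) add0r -tE divrK.
Qed.

(** For a function chi of period d with values in the field with three elements,
    the three holes contribute 3 chi = 0, so the correlation of chi with the
    subset sums is its total sum, a constant.  Hence chi is constant; for the
    indicator of the multiples of d this says that d divides 1. *)
Lemma hole_step_unit N n (alpha : 'I_n -> 'Z_N) m d : 1 < N -> odd N ->
  (forall j, alpha j \is a GRing.unit)%R -> injective (csum alpha m) ->
  (forall x, ~~ hole d x = [exists K, csum alpha m K == x]) -> d != 0%R ->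
  d \is a GRing.unit.
Proof.
move=> N1 oN ual inj hd d0.
pose chi (x : 'Z_N) : 'F_3 := if [exists c, x == c * d]%R then 1%R else 0%R.
have chid x : chi (x + d)%R = chi x.
  rewrite /chi; congr (if _ then _ else _); apply/existsP/existsP => -[c /eqP e].
    by exists (c - 1)%R; rewrite mulrBl mul1r -e addrK.
  by exists (c + 1)%R; rewrite mulrDl mul1r -e.
have chiN x : chi (x - d)%R = chi x by rewrite -[in RHS](subrK d x) chid.
have total x : (\sum_(K : {set 'I_n}) chi (x - csum alpha m K) = \sum_y chi y)%R.
  rewrite [RHS](reindex_inj (subrI x)) [RHS](bigID (hole d)) /=.
  have -> : (\sum_(y | hole d y) chi (x - y) = 0)%R.
    rewrite (eq_bigl (fun y => y \in [set 0; d; - d]%R)); last by move=> y; rewrite !inE.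
    rewrite -setUA big_setU1 ?big_setU1 ?big_set1 ?inE; last first.
    - by rewrite !(eq_sym 0%R) oppr_eq0 (negbTE d0).
    - apply: contraNneq d0 => dN; rewrite -(mulKr (unit2 N1 oN) d).
      by rewrite (_ : 2%:R * d = d + d)%R; [rewrite {2}dN subrr mulr0 | ring].
    rewrite /= subr0 opprK chid chiN -mulr2n -mulrS -mulr_natr.
    by rewrite (_ : 3%:R = 0)%R ?mulr0 //; apply/val_inj.
  rewrite add0r.
  have imE y : ~~ hole d y = (y \in [set csum alpha m K | K in [set: {set 'I_n}]]).
    rewrite hd; apply/existsP/imsetP => -[K]; first by move=> /eqP<-; exists K.
    by move=> _ ->; exists K.
  rewrite (eq_bigl _ _ imE) big_imset /=; last by move=> K K' _ _; apply: inj.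
  by apply: eq_bigl => K; rewrite inE.
have const x : chi x = chi 0%R.
  apply: (@subset_sum_profile_const N _ 'I_n alpha chi N1 oN ual setT) => {}x.
  transitivity (\sum_y chi y)%R.
    rewrite -(total (x - m)%R); apply: eq_big => [K|K _]; first by rewrite subsetT.
    by congr chi; rewrite /csum opprB addrA subrK.
  rewrite -(total (- m)%R); apply: eq_big => [K|K _]; first by rewrite subsetT.
  by congr chi; rewrite /csum opprB addrA addNr add0r.
have : chi 1%R = 1%R.
  by rewrite const /chi; case: existsP => // -[]; exists 0%R; rewrite mul0r.
rewrite /chi; case: existsP => // -[c /eqP e] _.
by apply/unitrP; exists c; rewrite [(d * c)%R]mulrC -e.
Qed.

(** * Families equal to signed powers of two up to a unit *)

Definition signed_powers N n (alpha : 'I_n -> 'Z_N) :=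
  exists a : 'Z_N, exists e : 'I_n -> 'I_n, [/\ a \is a GRing.unit, injective e &
    forall j, alpha j = a * (2 ^ e j)%:R \/ alpha j = - (a * (2 ^ e j)%:R)]%R.

(** The member a = alpha i gets exponent 0, and a member equal to 2a * 2^k or its
    opposite gets exponent k + 1. *)
Lemma signed_powers_of_blocks N n (alpha : 'I_n.+1 -> 'Z_N) m i x0 p q :
  1 < N -> odd N -> alpha i \is a GRing.unit -> injective (csum alpha m) ->
  (forall z, z < N ->
    csum_avoiding alpha m i (x0 + 2%:R * alpha i * z%:R)%R = blocks p q z) ->
  4 * p + 2 * q + 1 <= N -> p = 0 /\ q = 2 ^ n \/ 0 < p /\ 4 * p + 2 <= q ->
  signed_powers alpha.
Proof.
move=> N1 oN ua inj bl Npq pq.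
set w := (2%:R * alpha i)%R in bl *.
have uw : (w \is a GRing.unit)%R by rewrite unitrMl // unit2.
pose be (j : 'I_n) := (w^-1 * alpha (lift i j))%R.
pose x1 : 'Z_N := (w^-1 * (- m - x0))%R.
have sumE (K : {set 'I_n}) :
    (x1 + \sum_(j in K) be j = w^-1 * (csum alpha m (lift i @: K) - x0))%R.
  rewrite -mulr_sumr -mulrDr; congr (_ * _)%R; rewrite /csum big_imset /=; first by ring.
  by move=> j j' _ _; apply: lift_inj.
have imL (K : {set 'I_n}) : i \notin lift i @: K.
  by apply/imsetP => -[j _ /eqP]; apply/negP; rewrite neq_lift.
have imLE (K : {set 'I_n.+1}) : i \notin K -> K = lift i @: (lift i @^-1: K).
  move=> iK; apply/setP => j; apply/idP/imsetP => [jK|[j' + ->]]; last by rewrite inE.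
  case: (unliftP i j) => [j' ej|ej]; last by rewrite -ej jK in iK.
  by exists j'; rewrite // inE -ej.
have [|||k injk kP] := @blocks_subset_sums N 'I_n be x1 p q N1 oN Npq.
- by rewrite card_ord.
- move=> K K'; rewrite !sumE => /(mulrI (etrans (unitrV _) uw)) /addIr /inj /imset_inj.
  by apply; apply: lift_inj.
- move=> z zN; rewrite -bl //; split=> [/existsP[K /andP[iK /eqP eK]]|[K]].
    exists (lift i @^-1: K); rewrite sumE -imLE // eK addrAC subrr add0r mulKr //.
  rewrite sumE => eK; apply/existsP; exists (lift i @: K); rewrite imL /=.
  by rewrite -eK mulVKr // addrC subrK.
have k_lt j : k j < n by have [] := kP j; rewrite card_ord.
pose E j : nat := if unlift i j is Some j' then (k j').+1 else 0.
have E_lt j : E j < n.+1 by rewrite /E; case: unliftP => [j' _|_] //; rewrite ltnS k_lt.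
exists (alpha i), (fun j => Ordinal (E_lt j)); split=> //.
  move=> j j' /(congr1 val) /=; rewrite /E.
  case: unliftP => [l ->|->]; case: unliftP => [l' ->|->] // [].
  by move=> /injk->.
move=> j /=; rewrite /E; case: unliftP => [l ->|->]; last by left; rewrite mulr1.
have [_] := kP l; rewrite /be => h.
have wE : alpha (lift i l) = (w * (w^-1 * alpha (lift i l)))%R by rewrite mulVKr.
have powE : (alpha i * (2 ^ (k l).+1)%:R = w * (2 ^ k l)%:R)%R.
  by rewrite expnS natrM /w; ring.
by rewrite powE wE; case: h => ->; [left|right; rewrite mulrN].
Qed.

(** When N <= 6u, the positions 4u and 5u fall on the same side of the tiling: this is
    a comparison of the parities of their residues in the ranges of u cut out by
    N/5, N/4, N/3 and 2N/5. *)
Lemma profile_4_5 N u : 2 * u < N -> N <= 6 * u -> odd u -> odd N ->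
  exists y4 y5, [/\ y4 < N, y5 < N, y4 = 4 * u %[mod N], y5 = 5 * u %[mod N] &
    odd y4 (+) (u <= y4 < N - u) = odd y5 (+) (u <= y5 < N - u)].
Proof.
move=> uN N6 ou oN.
have modB c x : c * N <= x -> x - c * N = x %[mod N].
  by move=> h; rewrite -[in RHS](subnK h) addnC modnMDl.
exists (if 4 * u < N then 4 * u - 0 * N else 4 * u - 1 * N).
exists (if 5 * u < N then 5 * u - 0 * N
        else if 5 * u < 2 * N then 5 * u - 1 * N else 5 * u - 2 * N).
split.
- by case: ifP; lia.
- by case: ifP => ?; last case: ifP; lia.
- by case: ifP => ?; apply: modB; lia.
- by case: ifP => ?; last case: ifP => ?; apply: modB; lia.
- have [k NE] : exists k, N = 2 * k + 1 by exists N./2; lia.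
  have [p uE] : exists p, u = 2 * p + 1 by exists u./2; lia.
  case: ifP => h1; case: ifP => h2; try case: ifP => h3; lia.
Qed.

(** * A member for which the middle block dominates *)

(** The holes being 0, d and -d with d a unit, the residues 4d and 5d are centred
    sums of distinct subsets, so some member belongs to exactly one of them; by
    [profile_4_5] its u satisfies 6u < N. *)
Lemma small_profile N n (alpha : 'I_n -> 'Z_N) m d :
  1 < N -> odd N -> 7 <= N -> injective (csum alpha m) ->
  (forall K, csum alpha m (~: K) = - csum alpha m K)%R ->
  (forall x, ~~ hole d x = [exists K, csum alpha m K == x]) ->
  d \is a GRing.unit -> (forall j, alpha j \is a GRing.unit)%R ->
  exists i u, [/\ 6 * u < N, odd u &
    forall y, y < N ->
      csum_avoiding alpha m i (alpha i * y%:R)%R = odd y (+) (u <= y < N - u)].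
Proof.
move=> N1 oN N7 inj compl hd ud ual.
have d0 : d != 0%R by apply: contraTneq ud => ->; rewrite unitr0.
have /fin_all_exists[u uP] : forall i, exists u, [/\ 2 * u < N, odd u,
    (d = alpha i * u%:R \/ d = - (alpha i * u%:R))%R &
    forall y, y < N -> csum_avoiding alpha m i (alpha i * y%:R)%R = odd y (+) (u <= y < N - u)].
  by move=> i; apply: (tiles_profile N1 oN (csum_avoiding_tiles inj i hd) d0 (ual i)).
case: (boolP [exists i, 6 * u i < N]) => [/existsP[i ui]|/existsPn big].
  by exists i, (u i); case: (uP i).
have mul_neq0 k : 0 < k < N -> (d * k%:R != 0)%R.
  move=> kN; rewrite -(mulr0 d) (inj_eq (mulrI ud)) -[0%R]/(0%:R)%R Zp_natr_eq // !modn_small; lia.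
have not_hole k : 3 < k < 6 -> ~~ hole d (d * k%:R)%R.
  move=> k6; rewrite /hole -orbA; apply/norP; split; last apply/norP; try split.
  - by apply: mul_neq0; lia.
  - rewrite -subr_eq0 (_ : d * k%:R - d = d * (k.-1)%:R)%R ?mul_neq0 //; first lia.
    have kE : k = (k.-1 + 1)%N by lia.
    by rewrite {1}kE natrD mulrDr mulr1 addrK.
  - rewrite -subr_eq0 (_ : d * k%:R - - d = d * (k.+1)%:R)%R ?mul_neq0 //; first lia.
    by rewrite opprK -addn1 natrD mulrDr mulr1.
have [/existsP[K4 /eqP e4] /existsP[K5 /eqP e5]] :
    [exists K, csum alpha m K == d * 4%:R]%R /\ [exists K, csum alpha m K == d * 5%:R]%R.
  by rewrite -!hd !not_hole.
have eK : K4 = K5.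
  apply/setP => i.
  have [uN ou uE prof] := uP i.
  have N6 : N <= 6 * u i by rewrite leqNgt; apply: big.
  have [y4 [y5 [y4N y5N m4 m5 e45]]] := profile_4_5 uN N6 ou oN.
  have val4 : (alpha i * (u i)%:R * 4%:R = alpha i * y4%:R)%R.
    rewrite -mulrA -natrM; congr (_ * _)%R; apply/eqP; rewrite Zp_natr_eq // m4 mulnC //.
  have val5 : (alpha i * (u i)%:R * 5%:R = alpha i * y5%:R)%R.
    rewrite -mulrA -natrM; congr (_ * _)%R; apply/eqP; rewrite Zp_natr_eq // m5 mulnC //.
  have : csum_avoiding alpha m i (alpha i * y4%:R)%R = csum_avoiding alpha m i (alpha i * y5%:R)%R.
    by rewrite !prof.
  rewrite -val4 -val5; case: uE => dE.
    by rewrite -dE -e4 -e5 !csum_avoiding_csum // => /negb_inj.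
  have dE' : (alpha i * (u i)%:R = - d)%R by rewrite dE opprK.
  by rewrite dE' !mulNr -e4 -e5 -!compl !csum_avoiding_csum // !inE !negbK.
have := mul_neq0 1 ltac:(lia); suff -> : (d * 1%:R = 0)%R by rewrite eqxx.
have : (d * 5%:R - d * 4%:R = 0)%R by rewrite -e4 -e5 eK subrr.
by move=> <-; ring.
Qed.

(** All members are units: 3 is a unit modulo 2^n + 3, which covers the case of three
    holes.  With one hole every member gives a single block; with three
    holes the member provided by [small_profile] has 4p + 2 <= q or p = 0. *)
Lemma signed_powers_of_distinct_sums N n (alpha : 'I_n -> 'Z_N) :
  0 < n -> N = 2 ^ n + 1 \/ N = 2 ^ n + 3 ->
  injective (fun K : {set 'I_n} => \sum_(j in K) alpha j)%R ->
  signed_powers alpha.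
Proof.
case: n alpha => // n alpha _ NE inj.
have e2 : 2 ^ n.+1 = 2 * 2 ^ n by rewrite -expnS.
have e20 := expn_gt0 2 n.
have N1 : 1 < N by lia.
have oN : odd N by lia.
have [m [d [cinj compl hd NdE]]] := csum_holes (ltn0Sn n) NE inj.
have tU i := csum_avoiding_tiles cinj i hd.
have ual i : (alpha i \is a GRing.unit)%R.
  apply: (tiles_unit N1 oN (tU i)); case: NdE => [[_ d0]|[N3 _]]; [by left | right].
  rewrite unitZpE // coprime_sym prime_coprime // N3 dvdn_addl // Euclid_dvdX //.
case: NdE => [[N1E d0]|[N3E d0]].
  (* Here U consists of the odd multiples y of alpha ord0 below N; taking y = 2z - 1
     places them in the block from 1 to 2^n. *)
  apply: (@signed_powers_of_blocks N n alpha m ord0 (- alpha ord0)%R 0 (2 ^ n)) => //.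
  - move=> z zN.
    pose y := if z == 0 then N - 1 else if 2 * z - 1 < N then 2 * z - 1 else 2 * z - 1 - N.
    have -> : (- alpha ord0 + 2%:R * alpha ord0 * z%:R = alpha ord0 * y%:R)%R.
      have -> : (- alpha ord0 + 2%:R * alpha ord0 * z%:R = alpha ord0 * ((2 * z)%:R - 1%:R))%R.
        by rewrite natrM; ring.
      congr (_ * _)%R; rewrite /y; case: ifP => [/eqP-> | h1]; last case: ifP => h2.
      - by rewrite natrB ?Zp_natr_char ?muln0 //; lia.
      - by rewrite natrB //; lia.
      - by rewrite natrB ?natrB ?Zp_natr_char ?subr0 //; lia.
    have yN : y < N by rewrite /y; case: ifP => h1; last case: ifP => h2; lia.
    rewrite (tiles_profile0 N1 oN (tU ord0) d0 (ual ord0) yN) /blocks /y.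
    by case: ifP => h1; last case: ifP => h2; lia.
  - lia.
  - by left.
have ud := hole_step_unit N1 oN ual cinj hd d0.
case: n => [|n] in alpha NE inj e2 e20 m cinj compl hd N3E tU ual *.
  (* For n = 1 the residues 4d and 5d are holes (N = 5), but one unit is enough. *)
  exists (alpha ord0), id; split=> // j; rewrite (ord1 j) mulr1; by left.
have e3 := expnS 2 n; have e30 := expn_gt0 2 n.
have N7 : 7 <= N by lia.
have [i [u [u6 ou prof]]] := small_profile N1 oN N7 cinj compl hd ud ual.
pose p := u./2; have uE : u = 2 * p + 1 by rewrite /p; lia.
pose q := 2 ^ n.+1 - 2 * p.
have NE' : N = 4 * p + 2 * q + 3 by rewrite /q; lia.
apply: (@signed_powers_of_blocks N n.+1 alpha m i (- (alpha i * (2 * p)%:R))%R p q) => //.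
- by apply: (tiles_blocks (U := csum_avoiding alpha m i) N1 NE') => y yN; rewrite prof // uE.
- lia.
- case: (posnP p) => p0; [left | right]; last by rewrite /q; lia.
  by rewrite /q p0 muln0 subn0.
Qed.

(** * Binary expansions and sets of integers *)

Lemma binary_digits_inj n (f g : 'I_n -> bool) :
  \sum_i f i * 2 ^ i = \sum_i g i * 2 ^ i -> f =1 g.
Proof.
elim: n f g => [|n IH] f g; first by move=> _ [].
have expand (h : 'I_n.+1 -> bool) :
    \sum_i h i * 2 ^ i = h ord0 + 2 * \sum_i h (lift ord0 i) * 2 ^ i.
  rewrite big_ord_recl expn0 muln1 big_distrr; congr (_ + _).
  by apply: eq_bigr => i _; rewrite lift0 expnS mulnCA.
rewrite !expand => e.
have e0 : f ord0 = g ord0.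
  by move/(congr1 odd): e; rewrite !mul2n !oddD !odd_double !addbF !oddb.
have {}e : f \o lift ord0 =1 g \o lift ord0 by apply: IH => /=; move: e; rewrite e0 => /addnI/eqP; rewrite eqn_pmul2l // => /eqP.
by move=> i; case: (unliftP ord0 i) => [j ->|->] //; apply: e.
Qed.

Lemma sum_pow2_inj n : injective (fun K : {set 'I_n} => \sum_(j in K) 2 ^ j).
Proof.
move=> K K' /=; rewrite big_mkcond [RHS]big_mkcond => e; apply/setP.
apply: (binary_digits_inj (f := fun i => i \in K) (g := fun i => i \in K')).
by apply: etrans (etrans e _); apply: eq_bigr => i _; case: (_ \in _); rewrite ?mul1n.
Qed.

Lemma sum_pow2_lt n (K : {set 'I_n}) : \sum_(j in K) 2 ^ j < 2 ^ n.
Proof.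
have: \sum_(j < n) 2 ^ j < 2 ^ n.
  elim: n {K} => [|n IH]; first by rewrite big_ord0.
  by rewrite big_ord_recr /= expnS mul2n -addnn ltn_add2r.
by apply: leq_ltn_trans; rewrite [X in _ <= X](bigID [in K]) leq_addr.
Qed.

(** Up to signs and a unit, the sums are the integers below 2^n <= N, read off
    their binary expansions. *)
Lemma distinct_sums_of_signed_powers N n (alpha : 'I_n -> 'Z_N) :
  1 < N -> 2 ^ n <= N -> signed_powers alpha ->
  injective (fun K : {set 'I_n} => \sum_(j in K) alpha j)%R.
Proof.
move=> N1 nN [a [e [ua inje alE]]].
pose P := [set j | alpha j != a * (2 ^ e j)%:R]%R.
pose flip (K : {set 'I_n}) := [set j | (j \in K) (+) (j \in P)].
have flipK : involutive flip by move=> K; apply/setP=> j; rewrite !inE -addbA addbb addbF.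
have alE' j : (alpha j = if j \in P then - (a * (2 ^ e j)%:R) else a * (2 ^ e j)%:R)%R.
  by rewrite inE; case: eqP => //= ne; case: (alE j).
have sumE K : (\sum_(j in flip K) alpha j =
    \sum_(j in P) alpha j + a * (\sum_(i in e @: K) 2 ^ i)%N%:R)%R.
  rewrite (sum_sign_flip _ alE') big_imset /=; last by move=> i j _ _; apply: inje.
  by rewrite natr_sum mulr_sumr.
move=> K K' /=; rewrite -[K]flipK -[K']flipK !sumE => /addrI/(mulrI ua) h; congr flip.
apply: (imset_inj inje); apply: sum_pow2_inj; apply: Zp_natr_inj h => //;
  exact: leq_trans (sum_pow2_lt _) nN.
Qed.

Lemma Zp_intr_eq N (x y : int) : 1 < N ->
  (x%:~R == y%:~R :> 'Z_N)%R = (x == y %[mod N%:Z])%Z.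
Proof.
move=> N1; rewrite eqz_mod_dvd -subr_eq0 -rmorphB /= dvdzE /=.
have nE n : (n%:R == 0 :> 'Z_N)%R = (N %| n).
  by rewrite -[0%R]/(0%:R)%R Zp_natr_eq // mod0n.
by case: (x - y)%R => n /=; rewrite ?NegzE ?mulrNz ?oppr_eq0 nE.
Qed.

Lemma Zp_intr_unit N (x : int) : 1 < N -> gcdz x N%:Z = 1 -> (x%:~R : 'Z_N)%R \is a GRing.unit.
Proof.
move=> N1 [g1]; have : coprime N `|x| by rewrite /coprime gcdnC; apply/eqP.
by case: x {g1} => n; rewrite ?NegzE ?mulrNz ?unitrN -?pmulrn unitZpE.
Qed.

Lemma sumset_distinct_mod_family N n (a : 'I_n -> int) : 1 < N -> injective a ->
  sumset_distinct_mod N [fset a i | i in 'I_n]%fset <->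
  injective (fun K : {set 'I_n} => \sum_(i in K) ((a i)%:~R : 'Z_N))%R.
Proof.
move=> N1 inja.
pose B (K : {set 'I_n}) := [fset a i | i in K]%fset.
have BA K : (B K `<=` [fset a i | i in 'I_n])%fset.
  by apply/fsubsetP => x /imfsetP[i /= _ ->]; apply/imfsetP; exists i.
have memB K i : (a i \in B K) = (i \in K).
  by apply/imfsetP/idP => [[j /= jK /inja->]|iK] //; exists i.
have Binj : injective B by move=> K K' e; apply/setP => i; rewrite -!memB e.
have sumB K : ((\sum_(x <- B K) x)%:~R = \sum_(i in K) (a i)%:~R :> 'Z_N)%R.
  by rewrite big_imfset /= ?rmorph_sum ?big_enum //= => i j _ _; apply: inja.
have surB (C : {fset int}) : (C `<=` [fset a i | i in 'I_n])%fset -> exists K, C = B K.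
  move=> /fsubsetP CA; exists [set i | a i \in C]; apply/fsetP => x.
  apply/idP/imfsetP => [xC|[i /= + ->]]; last by rewrite inE.
  by have /imfsetP[i /= _ xE] := CA x xC; exists i; rewrite // inE -xE.
split=> [dist K K' /= e|inj C D /surB[K ->] /surB[K' ->] e].
  by apply: Binj; apply: dist => //; apply/eqP; rewrite -Zp_intr_eq // !sumB e.
by congr B; apply: inj; rewrite /= -!sumB; apply/eqP; rewrite Zp_intr_eq //; apply/eqP.
Qed.

Lemma fset_int_family n (A : {fset int}) : #|` A|%fset = n ->
  exists2 a : 'I_n -> int, injective a & A = [fset a i | i in 'I_n]%fset.
Proof.
move=> sA; have {}sA : size (enum_fset A) = n by []; exists (fun i => nth 0%R (enum_fset A) i).
  by move=> i j /eqP; rewrite nth_uniq ?fset_uniq ?sA ?ltn_ord // => /eqP/val_inj.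
apply/fsetP => x; apply/idP/imfsetP => [xA|[i _ ->]].
  have xi : index x (enum_fset A) < n by rewrite -sA index_mem.
  by exists (Ordinal xi); rewrite //= nth_index.
by rewrite -[_ \in A]/(_ \in enum_fset A) mem_nth // sA ltn_ord.
Qed.

Local Open Scope ring_scope.

Theorem theorem1p5 (n N : nat) (A : {fset int}) (n_ge1 : (1 <= n)%N)
    (hN : (N = 2 ^ n + 1)%N \/ (N = 2 ^ n + 3)%N)
    (cardA : #|` A|%fset = n) :
  sumset_distinct_mod N A <->
  exists (lambda : int) (sigma : 'I_n -> int) (a : 'I_n -> int),
    [/\ gcdz lambda N%:Z = 1,
        forall i : 'I_n, sigma i = 1 \/ sigma i = -1,
        injective a,
        A = [fset a i | i in 'I_n]%fset
      & forall i : 'I_n,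
          (a i = sigma i * lambda * 2%:Z ^+ i %[mod N%:Z])%Z].
Proof.
have nN : (2 ^ n <= N)%N by lia.
have N1 : (1 < N)%N by have := expn_gt0 2 n; lia.
have castE (s l : int) k :
    (s * l * 2%:Z ^+ k)%:~R = s%:~R * (l%:~R * (2 ^ k)%N%:R) :> 'Z_N.
  by rewrite !rmorphM rmorphXn /= natrX mulrA.
split=> [dist|[lambda [sigma [a [gl sg inja -> aE]]]]]; last first.
  apply/(sumset_distinct_mod_family N1 inja).
  apply: (distinct_sums_of_signed_powers N1 nN).
  exists lambda%:~R, id; split=> // [|j]; first exact: Zp_intr_unit.
  have /eqP := aE j; rewrite -Zp_intr_eq // castE => /eqP->.
  by case: (sg j) => ->; [left; rewrite mul1r | right; rewrite mulN1r].
have [a inja AE] := fset_int_family cardA.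
rewrite AE in dist *.
have inj := (sumset_distinct_mod_family N1 inja).1 dist.
have [v [e [uv inje vE]]] := signed_powers_of_distinct_sums n_ge1 hN inj.
have [g eK gK] := injF_bij inje.
exists (val v)%:Z, (fun i => if (a (g i))%:~R == v * (2 ^ i)%:R then 1 else -1), (a \o g).
split.
- have cv : coprime N (val v) by rewrite -unitZpE // natr_Zp.
  by rewrite /gcdz /= gcdnC (eqP cv).
- by move=> i; case: ifP; [left | right].
- exact: inj_comp inja (can_inj gK).
- apply/fsetP => x; apply/imfsetP/imfsetP => -[i _ ->]; last by exists (g i).
  by exists (e i); rewrite //= eK.
- move=> i; apply/eqP; rewrite -Zp_intr_eq // castE /= -pmulrn natr_Zp.
  case: ifP => [/eqP->|/eqP ne]; first by rewrite mul1r.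
  by have := vE (g i); rewrite gK mulN1r => -[] // ->.
Qed.
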